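(* Let $\Omega\subset\mathbb{R}^n$ be open and bounded, $N\in\mathbb{N}$, $u^c,u^\eta\in L^2(\Omega;\mathbb{R}^N)$. Let $\Lambda$ be a subset of a first countable topological space $X$ with closure $\overline\Lambda$, and for each $\lambda\in\Lambda$ let $\mathcal{R}_\lambda:L^2(\Omega)\to[0,\infty]$ be weakly $L^2$-lower semicontinuous with $\{v\in L^2(\Omega):\mathcal{R}_\lambda(v)<\infty\}\ne\emptyset$. For $\lambda\in\Lambda$ and $j\in\{1,\dots,N\}$ set $\mathcal{J}_{\lambda,j}(u)=\|u-u^\eta_j\|^2_{L^2(\Omega)}+\mathcal{R}_\lambda(u)$ for $u\in L^2(\Omega)$. Assume that for all $\lambda\in\overline\Lambda$ and $j\in\{1,\dots,N\}$ the $\Gamma$-limit $$\overline{\mathcal{J}}_{\lambda,j}:=\Gamma(w\text{-}L^2)\text{-}\lim_{\lambda'\to\lambda}\mathcal{J}_{\lambda',j}$$ exists, where $\lambda'$ takes values on arbitrary sequences in $\Lambda$. Let $\mathcal{I}$, $\overline{\mathcal{I}}$, $\mathcal{I}^{\rm rlx}$ and $\overline{K}_\lambda$ be defined as in the context. Suppose in addition that (i) the Mosco-limits $\overline{\mathcal{R}}_\lambda:=\mathrm{Mosc}(L^2)\text{-}\lim_{\lambda'\to\lambda}\mathcal{R}_{\lambda'}$ exist for each $\lambda\in\overline\Lambda$, with $\lambda'$ taking values on sequences in $\Lambda$, and (ii) $\overline{K}_\lambda$ is a singleton for every $\lambda\in\overline\Lambda\setminus\Lambda$. Then the extension $\overline{\mathcal{I}}$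 of $\mathcal{I}$ to $\overline\Lambda$ coincides with the relaxation of $\mathcal{I}$, i.e. $\overline{\mathcal{I}}=\mathcal{I}^{\rm rlx}$ on $\overline\Lambda$.
   Context: Norm convention: $\|v\|^2_{L^2(\Omega;\mathbb{R}^N)}=\sum_{j=1}^N\|v_j\|^2_{L^2(\Omega)}$. $\Gamma$- and Mosco-convergence: for $\mathcal{F}_k,\mathcal{F}:L^2(\Omega)\to[0,\infty]$, $\mathcal{F}=\Gamma(w\text{-}L^2)\text{-}\lim_{k}\mathcal{F}_k$ means: (liminf inequality) whenever $u_k\rightharpoonup u$ weakly in $L^2(\Omega)$, $\mathcal{F}(u)\le\liminf_k\mathcal{F}_k(u_k)$; and (limsup inequality) for every $u\in L^2(\Omega)$ there is $u_k\rightharpoonup u$ weakly in $L^2(\Omega)$ with $\mathcal{F}(u)\ge\limsup_k\mathcal{F}_k(u_k)$. If, in addition, the sequence in the limsup inequality can be chosen to converge strongly in $L^2(\Omega)$, then $\mathcal{F}=\mathrm{Mosc}(L^2)\text{-}\lim_k\mathcal{F}_k$. A limit ''$\lambda'\to\lambda$, with $\lambda'$ on sequences in $\Lambda$'' exists and equals $\mathcal{F}$ if for every sequence $(\lambda_k)_k\subset\Lambda$ with $\lambda_k\to\lambda$ the corresponding sequence of functionals converges to (the same) $\mathcal{F}$. Upper-level functional: for $\lambda\in\Lambda$, $\mathcal{I}(\lambda)=\inf_{w\in K_\lambda}\|w-u^c\|^2_{L^2(\Omega;\mathbb{R}^N)}$ with $K_\lambda=\{w\in L^2(\Omega;\mathbb{R}^N):w_j\in\operatorname{arg\,min}_{u\in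 L^2(\Omega)}\mathcal{J}_{\lambda,j}(u)\ \forall j\}$. Extension: for $\lambda\in\overline\Lambda$, $\overline{K}_\lambda=\{w\in L^2(\Omega;\mathbb{R}^N):w_j\in\operatorname{arg\,min}_{u\in L^2(\Omega)}\overline{\mathcal{J}}_{\lambda,j}(u)\ \forall j\}$ and $\overline{\mathcal{I}}(\lambda)=\min_{w\in\overline{K}_\lambda}\|w-u^c\|^2_{L^2(\Omega;\mathbb{R}^N)}$. (The minimum is attained, and $\overline{\mathcal{J}}_{\lambda,j}=\mathcal{J}_{\lambda,j}$ for $\lambda\in\Lambda$.) Relaxation: for $\lambda\in\overline\Lambda$, $\mathcal{I}^{\rm rlx}(\lambda)=\inf\{\liminf_{k\to\infty}\mathcal{I}(\lambda_k):(\lambda_k)_k\subset\Lambda,\ \lambda_k\to\lambda\text{ in }\overline\Lambda\}$. *)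

(* Defs.v *)
From HB Require Import structures.
From mathcomp Require Import all_boot all_order all_algebra.
From mathcomp Require Import all_classical all_reals all_analysis.

Set Implicit Arguments.
Unset Strict Implicit.
Unset Printing Implicit Defensive.

Import Order.TTheory GRing.Theory Num.Theory.
Import numFieldNormedType.Exports.

Local Open Scope classical_set_scope.
Local Open Scope ring_scope.

Section lebesgue_measure_tuple.
Context {R : realType}.
Let Rm := measurableTypeR R.

Section cons_measure.
Context {n : nat}.

Definition cons_tuple (p : Rm * n.-tuple Rm) : n.+1.-tuple Rm :=
  [tuple of p.1 :: p.2].

Lemma measurable_cons_tuple : measurable_fun [set: Rm * n.-tuple Rm] cons_tuple.
Proof. exact: measurable_cons. Qed.

Variable mu : {measure set (n.-tuple Rm) -> \bar R}.

(* [\x^] rather than [\x], as only its left factor has to be sigma-finite. *)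
Definition cons_measure : set (n.+1.-tuple Rm) -> \bar R :=
  pushforward (lebesgue_measure \x^ mu)%E cons_tuple.

HB.instance Definition _ := Measure.copy cons_measure
  (measure_function_pushforward__canonical__measure_function_Measure
    (lebesgue_measure \x^ mu)%E measurable_cons_tuple).
End cons_measure.

Fixpoint lebesgue_tuple (n : nat) : {measure set (n.-tuple Rm) -> \bar R} :=
  if n is n'.+1 then cons_measure (lebesgue_tuple n')
  else dirac ([tuple] : 0.-tuple Rm).

End lebesgue_measure_tuple.

(* R^n with its Borel sigma-algebra. *)
Definition euclidean (R : realType) (n : nat) : Type :=
  g_sigma_algebraType (@open 'rV[R]_n).

HB.instance Definition _ (R : realType) (n : nat) :=
  Measurable.copy (euclidean R n) (g_sigma_algebraType (@open 'rV[R]_n)).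

Section lebesgue_measure_euclidean.
Context {R : realType} {n : nat}.
Let Rm := measurableTypeR R.

Definition row_of_tuple (t : n.-tuple Rm) : euclidean R n :=
  (\row_i (tnth t i : R))%R.

Let ratbox (c : {ffun 'I_n -> rat * rat}) : set 'rV[R]_n :=
  [set x | forall i, x ord0 i \in `](ratr (c i).1 : R), ratr (c i).2[].

Let measurable_ratbox c : measurable (row_of_tuple @^-1` ratbox c).
Proof.
rewrite (_ : _ @^-1` _ = \bigcap_(i in [set: 'I_n])
    ((fun t : n.-tuple Rm => tnth t i) @^-1`
       [set` `](ratr (c i).1 : R), ratr (c i).2[])).
  apply: fin_bigcap_measurable => // i _; rewrite -[X in measurable X]setTI.
  by apply: measurable_tnth => //; exact: measurable_itv.
apply/seteqP; split => [t /= tc i _|t /= tc i]; first by move: (tc i); rewrite mxE.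
by rewrite mxE; exact: (tc i).
Qed.

Lemma measurable_row_of_tuple : measurable_fun [set: n.-tuple Rm] row_of_tuple.
Proof.
apply: (@measurability _ _ _ _ setT row_of_tuple (@open 'rV[R]_n)) => //.
move=> _ [U oU <-]; rewrite setTI.
have -> : U = \bigcup_(c in [set c | ratbox c `<=` U]) ratbox c.
  apply/seteqP; split => [x Ux|x [c /= cU cx]]; last exact: cU.
  have /nbhs_ballP[e /= e0 eU] : nbhs x U by exact: open_nbhs_nbhs.
  have P i : exists p : rat * rat,
      (x ord0 i - e < ratr p.1 < x ord0 i) /\
      (x ord0 i < ratr p.2 < x ord0 i + e).
    have /rat_in_itvoo[p] : x ord0 i - e < x ord0 i by rewrite ltrBlDr ltrDl.
    have /rat_in_itvoo[q] : x ord0 i < x ord0 i + e by rewrite ltrDl.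
    by rewrite !in_itv/= => ? ?; exists (p, q).
  have [f fP] := choice P.
  exists (finfun f) => [y /= fy|i]; last first.
    by rewrite ffunE in_itv/=; have [/andP[_ ->] /andP[-> _]] := fP i.
  apply: eU; split => // i j; rewrite /ball/= ord1 ltr_distlC.
  have := fy j; rewrite ffunE in_itv/= => /andP[fj1 fj2].
  have [/andP[xf1 _] /andP[_ xf2]] := fP j.
  by rewrite (lt_trans xf1)//= (lt_trans fj2).
rewrite bigcup_mkcond preimage_bigcup; apply: countable_bigcupT_measurable.
  exact: countableP.
by move=> c; case: ifPn => _; [exact: measurable_ratbox|rewrite preimage_set0].
Qed.

Definition lebesgue_euclidean : set (euclidean R n) -> \bar R :=
  pushforward (lebesgue_tuple n) row_of_tuple.

HB.instance Definition _ := Measure.copy lebesgue_euclidean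
  (measure_function_pushforward__canonical__measure_function_Measure
    (lebesgue_tuple n) measurable_row_of_tuple).

Lemma open_measurable_euclidean (U : set 'rV[R]_n) :
  open U -> measurable (U : set (euclidean R n)).
Proof. exact: sub_sigma_algebra. Qed.

End lebesgue_measure_euclidean.

Lemma lebesgue_tuple_box (R : realType) n (a b : 'I_n -> R) :
  (forall i, a i <= b i) ->
  lebesgue_tuple n [set t : n.-tuple (measurableTypeR R) |
    forall i, tnth t i \in `[a i, b i]] = (\prod_(i < n) (b i - a i))%:E.
Proof.
elim: n a b => [|n IH] a b ab.
  by rewrite /= diracE mem_set ?big_ord0// => -[].
rewrite /= /cons_measure /pushforward.
rewrite (_ : _ @^-1` _ = [set` `[a ord0, b ord0]] `*`
  [set t : n.-tuple (measurableTypeR R) |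
    forall i, tnth t i \in `[a (lift ord0 i), b (lift ord0 i)]]); last first.
  apply/seteqP; split => [[x t] /= H|[x t] /= [H0 H] i].
    split; first by have := H ord0.
    by move=> i; have := H (lift ord0 i); rewrite tnthS.
  by case: (unliftP ord0 i) => [j|] ->; [rewrite tnthS; exact: H|].
rewrite product_measure2E; [|exact: measurable_itv|].
  rewrite IH// [X in (X * _)%E](lebesgue_measure_itv `[a ord0, b ord0]) /=
    lte_fin big_ord_recl EFinM.
  case: ltP => // ba; have /eqP -> : a ord0 == b ord0 by rewrite eq_le ab ba.
  by rewrite subrr.
rewrite (_ : [set t | _] = \bigcap_(i in [set: 'I_n])
    ((fun t : n.-tuple (measurableTypeR R) => tnth t i) @^-1`
     [set` `[a (lift ord0 i), b (lift ord0 i)]])).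
  apply: fin_bigcap_measurable => // i _; rewrite -[X in measurable X]setTI.
  by apply: measurable_tnth => //; exact: measurable_itv.
by apply/seteqP; split => [t tc i _|t tc i]; exact: (tc i).
Qed.

Lemma lebesgue_euclidean_box (R : realType) n (a b : 'I_n -> R) :
  (forall i, a i <= b i) ->
  lebesgue_euclidean [set x : 'rV[R]_n | forall i, x ord0 i \in `[a i, b i]] =
  (\prod_(i < n) (b i - a i))%:E.
Proof.
move=> ab; rewrite -(lebesgue_tuple_box ab) /lebesgue_euclidean /pushforward.
congr (lebesgue_tuple n _); apply/seteqP.
by split => [t /= + i|t /= + i] => /(_ i); rewrite mxE.
Qed.

Section L2_functionals.
Context {d : measure_display} {T : measurableType d} {R : realType}.
Context {mu : {measure set T -> \bar R}}.
Local Notation L2 := (LspaceType2 mu).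
Implicit Types (u v w : L2) (F : L2 -> \bar R).

Definition L2dist u v : \bar R :=
  Lnorm mu 2%:E (fun x => ((u x : R) - v x)%:E).

Definition L2_cvg (u_ : nat -> L2) u :=
  (fun k => L2dist (u_ k) u) @ \oo --> 0%E.

(* Continuous linear functionals on L2 are represented by elements of L2. *)
Definition L2_weak_cvg (u_ : nat -> L2) u := forall v,
  (fun k => \int[mu]_x ((u_ k x : R) * v x)%:E)%E @ \oo -->
  (\int[mu]_x ((u x : R) * v x)%:E)%E.

(* Sequential lower semicontinuity for the weak topology. *)
Definition weakly_lsc F := forall (u_ : nat -> L2) u,
  L2_weak_cvg u_ u -> (F u <= limn_einf (F \o u_))%E.

Definition Gamma_lim (F_ : nat -> L2 -> \bar R) F :=
  (forall (u_ : nat -> L2) u, L2_weak_cvg u_ u -> (F u <= limn_einf (fun k => F_ k (u_ k)))%E)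
  /\
  (forall u, exists2 u_, L2_weak_cvg u_ u &
    (limn_esup (fun k => F_ k (u_ k)) <= F u)%E).

Definition Mosco_lim (F_ : nat -> L2 -> \bar R) F :=
  Gamma_lim F_ F /\
  (forall u, exists2 u_, L2_cvg u_ u &
    (limn_esup (fun k => F_ k (u_ k)) <= F u)%E).

Definition argmin F : set L2 := [set u | forall v, (F u <= F v)%E].

Section limits_along_a_set.
Context {X : topologicalType} (Lambda : set X).

Definition sequences_to (l : X) : set (nat -> X) :=
  [set l_ | (forall k, Lambda (l_ k)) /\ l_ @ \oo --> l].

Definition Gamma_lim_at (F_ : X -> L2 -> \bar R) (l : X) F :=
  forall l_, sequences_to l l_ -> Gamma_lim (F_ \o l_) F.

Definition Mosco_lim_at (F_ : X -> L2 -> \bar R) (l : X) F :=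
  forall l_, sequences_to l l_ -> Mosco_lim (F_ \o l_) F.

Definition relaxation (I : X -> \bar R) (l : X) : \bar R :=
  ereal_inf [set limn_einf (I \o l_) | l_ in sequences_to l].

End limits_along_a_set.

Section bilevel.
Context {N : nat}.

(* An element of L2(Omega; R^N) is given by its N components. *)
Definition L2dist2_vec (w z : 'I_N -> L2) : \bar R :=
  (\sum_(j < N) L2dist (w j) (z j) ^+ 2)%E.

Definition lower_level {X : Type} (ueta : 'I_N -> L2) (Reg : X -> L2 -> \bar R)
    (l : X) (j : 'I_N) : L2 -> \bar R :=
  fun u => (L2dist u (ueta j) ^+ 2 + Reg l u)%E.

Definition solutions (J : 'I_N -> L2 -> \bar R) : set ('I_N -> L2) :=
  [set w | forall j, argmin (J j) (w j)].

(* For J := J_l this is I(l); for J := Jbar_l it is the extension of I, whose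
   infimum is attained. *)
Definition upper_level (uc : 'I_N -> L2) (J : 'I_N -> L2 -> \bar R) : \bar R :=
  ereal_inf [set L2dist2_vec w uc | w in solutions J].

End bilevel.
End L2_functionals.

Definition lebesgue_on (R : realType) (n : nat) (Omega : set 'rV[R]_n)
    (openOmega : open Omega) : {measure set (euclidean R n) -> \bar R} :=
  mrestr (@lebesgue_euclidean R n) (open_measurable_euclidean openOmega).

(* Functions on R^n that agree almost everywhere on Omega are the same
   element, so that values outside Omega are irrelevant. *)
Definition L2_on (R : realType) (n : nat) (Omega : set 'rV[R]_n)
    (openOmega : open Omega) : Type :=
  LspaceType2 (lebesgue_on openOmega).

Definition first_countable (X : topologicalType) := forall x : X,
  exists2 B : set (set X), countable B /\ B `<=` nbhs x &
    forall A, nbhs x A -> exists2 U, B U & U `<=` A.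

(* Main.v *)
Require Import Defs.
From HB Require Import structures.
From mathcomp Require Import all_boot all_order all_algebra.
From mathcomp Require Import all_classical all_reals all_analysis.
From mathcomp Require Import measurable_realfun ring lra.
Import Order.TTheory GRing.Theory Num.Theory.
Import numFieldNormedType.Exports.
Local Open Scope classical_set_scope.
Local Open Scope ring_scope.

(** The two inequalities between the extension and the relaxation rest on the
    sequential weak compactness of bounded sets of L2.

    Extension <= relaxation ([upper_level_le_relaxation]).  If I(l_k) < c
    along a subsequence of l_k -> l, pick minimizers w_k whose squared
    distance to uc is below c.  They are bounded, hence converge weakly to some
    w along a further subsequence; Gamma-convergence makes w a minimizer for
    the limit functionals ([solutions_weak_limit]), and weak lower
    semicontinuity of the distance bounds the extension at l by c.

    Relaxation <= extension.  For l in Lambda, weak lower semicontinuity makes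
    the Gamma-limit along the constant sequence the functional itself, so the
    constant sequence is a competitor ([relaxation_le_at_Lambda]).  For l
    outside Lambda ([relaxation_le_notin_Lambda]) take any l_k -> l and
    minimizers w_k; again they converge weakly to a minimizer, which must be
    the single element w of the limiting solution set.  The point is that this
    convergence is strong: comparing w_k with a strong recovery sequence of w
    for the regularizers cancels the regularizing terms and leaves
    limsup |w_k - ueta| <= |w - ueta|, which together with weak convergence
    gives limsup |w_k - uc| <= |w - uc| ([Mosco_lim_minimizers]).

    Weak compactness is proved for a complete semi-inner product.  A
    subsequence whose inner products with each of its own terms converge is
    obtained from an ultrafilter ([diagonal_subsequence]).  Near-minimal-norm
    elements of the convex hulls of its tails form a Cauchy sequence by the
    parallelogram identity ([midpoint_hull_cvg]); their limit is the weak limit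
    ([weak_limit]).  Completeness of L2 is the Riesz-Fischer theorem
    ([L2dot_complete]).  A semi-inner product suffices, so that one can work
    with square-integrable functions, which form a vector space, and pass to
    classes modulo almost-everywhere equality only at the end. *)

Set Implicit Arguments.
Unset Strict Implicit.
Unset Printing Implicit Defensive.

(** * Subsequences *)

Lemma subseq_cvgy (f : nat -> nat) : (forall n, (n <= f n)%N) -> f @ \oo --> \oo.
Proof. 
move=> nf A [n _ nA]; exists n => // m /= nm; apply: nA => /=; exact: leq_trans nm _.
Qed.

(** An ultrafilter finer than the cofinite filter assigns a limit to every
    bounded sequence at once, and [f n] may be any index beyond [n] at which
    the first [n] sequences are close to these limits.  Such an [f] need not be
    increasing; tending to infinity is all that later arguments use. *)
Lemma diagonal_subsequence {R : realType} (I : countType) (a : I -> nat -> R) :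
  (forall i, exists M : R, \forall k \near \oo, `|a i k| <= M) ->
  exists2 f : nat -> nat, (forall n, (n <= f n)%N) & forall i, cvgn (a i \o f).
Proof.
move=> bnd; have [U [UU sU]] := @ultraFilterLemma nat \oo _.
have lim i : exists l : R, a i @ U --> l.
  have [M aM] := bnd i.
  have : compact [set` `[- M, M]] by exact: segment_compact.
  move=> /(_ (a i @ U)) [].
    apply: sU; near=> k; rewrite /= in_itv/= -ler_norml; near: k; exact: aM.
  move=> l [_ ll]; exists l => N Nl.
  have [//|UC] := in_ultra_setVsetC (a i @^-1` N) UU.
  have [x []] := ll (~` N) N UC Nl; by [].
have [l lP] := choice lim.
pose good n := [set k | (n <= k)%N] `&`
  [set k | forall m : 'I_n, forall i, unpickle m = Some i -> `|l i - a i k| < n.+1%:R^-1].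
have goodU n : U (good n).
  apply: filterI; first by apply: sU; exists n.
  apply: filter_forall => m; case: (unpickle m) => [i|]; last first.
    by apply: filterS filterT => k _ i.
  have /cvgrPdist_lt/(_ n.+1%:R^-1) := lP i.
  rewrite invr_gt0 ltr0Sn => /(_ isT); apply: filterS => k + _ [<-]; exact.
have [f fP] := choice (fun n => filter_ex (goodU n)).
exists f => [n|i]; first by have [] := fP n.
apply/cvg_ex; exists (l i); apply/cvgrPdist_lt => e e0.
near=> n; have [_ /=] := fP n.
have pn : (pickle i < n)%N by near: n; exact: nbhs_infty_gt.
move=> /(_ (Ordinal pn) i (pickleK i))/lt_trans; apply.
near: n.
have := @cvgr_lt R nat \oo _ (fun n => n.+1%:R^-1) 0 (@cvg_harmonic R) e e0; exact.
Unshelve. all: by end_near. Qed.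

(** * Weak limits for a semi-inner product *)

Section semi_inner_product.
Context {R : realType} {V : lmodType R} (dot : V -> V -> R).

Record semi_inner_product := SemiInnerProduct {
  sip_sym : forall x y, dot x y = dot y x ;
  sip_linear : forall a x y z, dot (a *: x + y) z = a * dot x z + dot y z ;
  sip_ge0 : forall x, 0 <= dot x x }.

Local Notation nsq x := (dot x x).

(** Cauchy sequences are given with an explicit modulus [e]; the limit is
    unique only up to vectors of norm zero. *)
Definition sip_complete := forall (x_ : nat -> V) (e : nat -> R),
  e @ \oo --> 0 ->
  (forall k l, (k <= l)%N -> nsq (x_ l - x_ k) <= e k) ->
  exists x, (fun k => nsq (x_ k - x)) @ \oo --> 0.

(** Midpoints replace general convex combinations: they are what the
    parallelogram identity needs, and give an induction principle. *)
Inductive midpoint_hull (A : set V) : set V :=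
| hull_mem x : A x -> midpoint_hull A x
| hull_mid x y : midpoint_hull A x -> midpoint_hull A y ->
    midpoint_hull A (2^-1 *: (x + y)).

Lemma midpoint_hullS (A B : set V) :
  A `<=` B -> midpoint_hull A `<=` midpoint_hull B.
Proof.
move=> AB x; elim=> [y /AB|y z _ Hy _ Hz]; [exact: hull_mem|exact: hull_mid].
Qed.

Hypothesis dotP : semi_inner_product.

Lemma sip0l x : dot 0 x = 0.
Proof.
by have := sip_linear dotP (-1) 0 0 x; rewrite scaler0 addr0 mulN1r addNr.
Qed.

Lemma sipDl x y z : dot (x + y) z = dot x z + dot y z.
Proof. by rewrite -[x in LHS]scale1r (sip_linear dotP) mul1r. Qed.

Lemma sipZl a x y : dot (a *: x) y = a * dot x y.
Proof. by rewrite -[a *: x]addr0 (sip_linear dotP) sip0l addr0. Qed.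

Lemma sipDr x y z : dot x (y + z) = dot x y + dot x z.
Proof. by rewrite !(sip_sym dotP x) sipDl. Qed.

Lemma sipZr a x y : dot x (a *: y) = a * dot x y.
Proof. by rewrite !(sip_sym dotP x) sipZl. Qed.

Lemma sipNl x y : dot (- x) y = - dot x y.
Proof. by rewrite -scaleN1r sipZl mulN1r. Qed.

Lemma sipNr x y : dot x (- y) = - dot x y.
Proof. by rewrite !(sip_sym dotP x) sipNl. Qed.

Lemma sipBl x y z : dot (x - y) z = dot x z - dot y z.
Proof. by rewrite sipDl sipNl. Qed.

Lemma sipBr x y z : dot x (y - z) = dot x y - dot x z.
Proof. by rewrite sipDr sipNr. Qed.

Lemma sip_sqrB x y : nsq (x - y) = nsq x - 2 * dot x y + nsq y.
Proof. rewrite !(sipBl, sipBr) (sip_sym dotP y x); ring. Qed.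

Lemma sip_le_half_sqr x y : `|dot x y| <= (nsq x + nsq y) / 2.
Proof.
have := sip_ge0 dotP (x - y); have := sip_ge0 dotP (x + y).
rewrite sip_sqrB sipDl !sipDr (sip_sym dotP y x) ler_norml => h1 h2.
by apply/andP; split; lra.
Qed.

(** The Cauchy-Schwarz inequality in a form that avoids square roots and the
    case distinction on vectors of norm zero. *)
Lemma sip_young x y e : 0 < e -> dot x y <= (e * nsq y + e^-1 * nsq x) / 2.
Proof.
move=> e0; have := sip_ge0 dotP (x - e *: y).
rewrite sip_sqrB sipZr sipZl sipZr => h.
have : 0 <= e^-1 * (nsq x - 2 * (e * dot x y) + e * (e * nsq y)).
  by rewrite mulr_ge0// invr_ge0 ltW.
have -> : e^-1 * (nsq x - 2 * (e * dot x y) + e * (e * nsq y)) =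
  e^-1 * nsq x - 2 * dot x y + e * nsq y by field; rewrite gt_eqF.
lra.
Qed.

Lemma sip_cvg (x_ : nat -> V) x y :
  (fun k => nsq (x_ k - x)) @ \oo --> 0 ->
  (fun k => dot (x_ k) y) @ \oo --> dot x y.
Proof.
move=> xx; apply/subr_cvg0/cvgrPdist_lt => e e0.
pose d := e / (nsq y + 1).
have y1 : 0 < nsq y + 1 by rewrite ltr_wpDl// (sip_ge0 dotP).
have d0 : 0 < d by rewrite divr_gt0.
have dy : d * nsq y <= e.
  have -> : e = d * (nsq y + 1) by rewrite divfK// gt_eqF.
  by rewrite ler_wpM2l ?(ltW d0)//; lra.
have /(@cvgr_lt R nat \oo _ _ 0)/(_ (e * d)) := xx.
rewrite mulr_gt0// => /(_ isT); apply: filterS => k /= H.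
have Hd : d^-1 * nsq (x_ k - x) < e by rewrite mulrC ltr_pdivrMr.
rewrite sub0r normrN -sipBl ltr_norml.
have H1 := sip_young (x_ k - x) y d0.
have H2 : dot (- (x_ k - x)) y <= (d * nsq y + d^-1 * nsq (x_ k - x)) / 2.
  apply: le_trans (sip_young (- (x_ k - x)) y d0) _.
  by rewrite !(sipNl, sipNr) opprK.
move: H2; rewrite sipNl; set a := dot _ _ in H1 *.
by move=> H2; apply/andP; split; lra.
Qed.

(** The squared distance of the origin to the hulls of the tails is
    nondecreasing and bounded, hence Cauchy; by the parallelogram identity,
    elements that nearly realize this distance form a Cauchy sequence too.
    The set [D] selects a subsequence without naming its indices. *)
Lemma midpoint_hull_cvg (y_ : nat -> V) (M : R) (D : set nat) :
  sip_complete ->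
  (\forall k \near \oo, nsq (y_ k) <= M) ->
  (forall k, exists2 m, (k <= m)%N & D m) ->
  exists (x_ : nat -> V) (x : V),
    (forall k, midpoint_hull (y_ @` [set m | (k <= m)%N /\ D m]) (x_ k)) /\
    (fun k => nsq (x_ k - x)) @ \oo --> 0.
Proof.
move=> complete [K _ KM] Dinf.
pose C k := midpoint_hull (y_ @` [set m | (k <= m)%N /\ D m]).
have CS k l : (k <= l)%N -> C l `<=` C k.
  move=> kl; apply: midpoint_hullS => _ [m [lm Dm] <-].
  by exists m => //; split => //; exact: leq_trans lm.
pose S k := [set nsq x | x in C k]; pose d k := inf (S k).
have C0 k : exists2 x, C k x & nsq x <= M.
  have [m km Dm] := Dinf (maxn k K); move: km; rewrite geq_max => /andP[km Km].
  by exists (y_ m); [apply: hull_mem; exists m|exact: KM].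
have hinf k : has_inf (S k).
  split; first by have [x Cx _] := C0 k; exists (nsq x), x.
  by exists 0 => _ [x _ <-]; exact: sip_ge0.
have dle k x : C k x -> d k <= nsq x.
  by move=> Cx; apply: ge_inf; [exact: (hinf k).2|exists x].
have dmono : nondecreasing_seq d.
  move=> k l kl; apply: lb_le_inf; first exact: (hinf l).1.
  by move=> _ [x Cx <-]; apply: dle; exact: CS kl _ Cx.
have dM k : d k <= M by have [x Cx] := C0 k; apply: le_trans; exact: dle.
have cvd : cvgn d.
  by apply: nondecreasing_is_cvgn => //; exists M => _ [k _ <-].
have ds k : d k <= limn d by exact: nondecreasing_cvgn_le.
have ex k : exists x, C k x /\ nsq x <= d k + k.+1%:R^-1.
  have [|_ [x Cx <-] H] := @inf_adherent _ (S k) k.+1%:R^-1 _ (hinf k).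
    by rewrite invr_gt0.
  by exists x; split => //; exact: ltW.
have [x_ xP] := choice ex.
pose e k := 2 * (limn d - d k) + 4 * k.+1%:R^-1.
have e0 : e @ \oo --> 0.
  rewrite [X in _ --> X](_ : 0 = 2 * (limn d - limn d) + 4 * 0); last by lra.
  apply: cvgD; apply: cvgM; [exact: cvg_cst| |exact: cvg_cst|exact: cvg_harmonic].
  by apply: cvgB; [exact: cvg_cst|exact: cvd].
have [|x xx] := complete x_ e e0; last by exists x_, x; split => // k; case: (xP k).
move=> k l kl; have [Ck xk] := xP k; have [Cl xl] := xP l.
have := dle k _ (hull_mid Ck (CS _ _ kl _ Cl)).
rewrite sip_sqrB sipZl sipZr sipDl !sipDr (sip_sym dotP (x_ l) (x_ k)) => H.
have H2 := ds l.
have H3 : l.+1%:R^-1 <= k.+1%:R^-1 :> R by rewrite lef_pV2 ?posrE// ler_nat ltnS.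
rewrite /e; move: H2 H xk xl H3; move: (limn d : R) (d k) (d l).
move: (k.+1%:R^-1) (l.+1%:R^-1) (dot _ _) (dot _ _) (dot _ _) => *; lra.
Qed.

Lemma midpoint_hull_dot (A : set V) (v : V) (P : R -> Prop) :
  (forall a b, P a -> P b -> P ((a + b) / 2)) ->
  (forall x, A x -> P (dot x v)) ->
  forall x, midpoint_hull A x -> P (dot x v).
Proof.
move=> Pmid AP x; elim=> [y /AP//|y z _ Hy _ Hz].
by rewrite sipZl sipDl mulrC; exact: Pmid.
Qed.

(** The candidate is a limit [u] of elements of the hulls of the tails.  If
    [dot (y_ k) v] exceeded [dot u v] by [e] for infinitely many [k], the same
    construction on those indices would give [z] with
    [dot z v >= dot u v + e].  Both [u] and [z] represent the limits of
    [dot (y_ k) (y_ m)], so [z - u] is orthogonal to every [y_ m], hence to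
    [z] and [u] as limits of hull elements, and has norm zero: a
    contradiction. *)
Lemma weak_limit (y_ : nat -> V) (M : R) :
  sip_complete ->
  (\forall k \near \oo, nsq (y_ k) <= M) ->
  (forall m, cvgn (fun k => dot (y_ k) (y_ m))) ->
  exists u, forall v, (fun k => dot (y_ k) v) @ \oo --> dot u v.
Proof.
move=> complete yM ycvg.
(* A limit of hull elements represents every limit that exists along [y_]. *)
have hull_lim (D : set nat) (x_ : nat -> V) x v (c : R) :
    (forall k, midpoint_hull (y_ @` [set m | (k <= m)%N /\ D m]) (x_ k)) ->
    (fun k => nsq (x_ k - x)) @ \oo --> 0 ->
    (fun k => dot (y_ k) v) @ \oo --> c -> dot x v = c.
  move=> xhull xx yc; apply: (@cvg_unique _ (@Rhausdorff R)
    (fmap (fun k => dot (x_ k) v) \oo)).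
    exact: sip_cvg.
  apply/cvgrPdist_le => e e0.
  move/cvgrPdist_le : yc => /(_ e e0) [K _ KP]; exists K => // k /= Kk.
  apply: (@midpoint_hull_dot _ v (fun t => `|c - t| <= e) _ _ _ (xhull k)).
    by move=> a b; rewrite !ler_norml => /andP[? ?] /andP[? ?]; apply/andP; split; lra.
  by move=> _ [m [km _] <-]; apply: KP => /=; exact: leq_trans km.
have [x_ [u [xhull xu]]] := @midpoint_hull_cvg y_ M setT complete yM
  (fun k => ex_intro2 _ _ k (leqnn k) I).
exists u.
have upper v e : 0 < e -> \forall k \near \oo, dot (y_ k) v < dot u v + e.
  move=> e0; apply: contrapT => notnear.
  pose D := [set m | dot u v + e <= dot (y_ m) v].
  have Dinf k : exists2 m, (k <= m)%N & D m.
    apply: contrapT => H; apply: notnear; exists k => // m /= km.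
    by rewrite ltNge; apply/negP => ?; apply: H; exists m.
  have [z_ [z [zhull zz]]] := @midpoint_hull_cvg y_ M D complete yM Dinf.
  have uz m : dot (z - u) (y_ m) = 0.
    rewrite sipBl (hull_lim _ _ _ _ _ zhull zz (ycvg m)).
    by rewrite (hull_lim _ _ _ _ _ xhull xu (ycvg m)) subrr.
  have hull0 (A : set nat) x : midpoint_hull (y_ @` A) x -> dot x (z - u) = 0.
    apply: (@midpoint_hull_dot _ _ (fun t => t = 0)).
      by move=> a b -> ->; rewrite addr0 mul0r.
    by move=> _ [m _ <-]; rewrite (sip_sym dotP) uz.
  have lim0 w_ w (B : nat -> set nat) : (forall k, midpoint_hull (y_ @` B k) (w_ k)) ->
      (fun k => nsq (w_ k - w)) @ \oo --> 0 -> dot w (z - u) = 0.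
    move=> wB ww; apply: (@cvg_unique _ (@Rhausdorff R)
      (fmap (fun k => dot (w_ k) (z - u)) \oo)).
      exact: sip_cvg.
    by apply: cvg_near_cst; apply: nearW => k; exact: hull0 (wB k).
  have zu0 : nsq (z - u) = 0.
    by rewrite sipBl (lim0 _ _ _ zhull zz) (lim0 _ _ _ xhull xu) subrr.
  (* A vector of norm zero is orthogonal to all: view it as a sequence
     converging to 0. *)
  have zuv : dot (z - u) v = 0.
    have c0 : (fun=> dot (z - u) v) @ \oo --> dot 0 v.
      apply: (@sip_cvg (fun=> z - u)); rewrite subr0 zu0; exact: cvg_cst.
    rewrite -(sip0l v); apply: cvg_unique c0; first exact: Rhausdorff.
    exact: cvg_cst.
  have : dot u v + e <= dot z v.
    rewrite -(cvg_lim _ (@sip_cvg z_ z v zz))//.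
    apply: limr_ge; first by apply/cvg_ex; eexists; exact: sip_cvg zz.
    apply: nearW => k.
    apply: (@midpoint_hull_dot _ v (fun t => dot u v + e <= t) _ _ _ (zhull k)).
      by move=> a b ? ?; lra.
    by move=> _ [m [_ Dm] <-].
  by move: zuv; rewrite sipBl; lra.
(* The lower bound for [v] is the upper bound for [- v]. *)
move=> v; apply/cvgrPdist_lt => e e0.
have H1 := upper v e e0; have H2 := upper (- v) e e0.
near=> k; rewrite ltr_norml.
have : dot (y_ k) v < dot u v + e by near: k.
have : dot (y_ k) (- v) < dot u (- v) + e by near: k.
rewrite !sipNr => ? ?; apply/andP; split; lra.
Unshelve. all: by end_near. Qed.
End semi_inner_product.

(** * Completeness of the space of square-integrable functions *)

Section L2_inner_product.
Context {d : measure_display} {T : measurableType d} {R : realType}.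
Variable mu : {measure set T -> \bar R}.
Local Notation V := (LfunType mu (lee1n 2)).
Implicit Types f g h : V.

Lemma LfunDE f g : (f + g : V) = f \+ g :> (T -> R).
Proof. by []. Qed.
Lemma LfunZE a f : (a *: f : V) = a \*: (f : T -> R) :> (T -> R).
Proof. by []. Qed.
Lemma LfunBE f g : (f - g : V) = f \- g :> (T -> R).
Proof. by []. Qed.

Definition L2dot f g : R := \int[mu]_x (f x * g x).

Lemma integrable_L2mul f g : mu.-integrable setT (fun x => (f x * g x)%:E).
Proof.
by apply/Lfun1_integrable; apply: Lfun2_mul_Lfun1; exact: LfunP.
Qed.

Lemma EFin_L2dot f g : ((L2dot f g)%:E = \int[mu]_x (f x * g x)%:E)%E.
Proof.
rewrite /L2dot fineK//; apply: integrable_fin_num => //.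
exact: integrable_L2mul.
Qed.

Lemma L2dot_semi_inner_product : semi_inner_product L2dot.
Proof.
split.
- by move=> f g; apply: eq_Rintegral => x _; rewrite mulrC.
- move=> a f g h; rewrite /L2dot.
  rewrite -RintegralZl//; last exact: integrable_L2mul.
  rewrite -RintegralD//; last 2 first.
    by apply: (integrableZl measurableT a (integrable_L2mul f h)).
    exact: integrable_L2mul.
  by apply: eq_Rintegral => x _; rewrite LfunDE LfunZE /= mulrDl mulrA.
- by move=> f; apply: Rintegral_ge0 => x _; rewrite -expr2 sqr_ge0.
Qed.

Lemma L2dot_ae f f' g g' : ae_eq mu setT f f' -> ae_eq mu setT g g' ->
  L2dot f g = L2dot f' g'.
Proof.
move=> ff' gg'; apply: EFin_inj; rewrite !EFin_L2dot; apply: ae_eq_integral => //.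
- by apply/measurable_EFinP; exact: measurable_funM.
- by apply/measurable_EFinP; exact: measurable_funM.
- by apply: filterS2 ff' gg' => x /(_ I) -> // /(_ I) ->.
Qed.

Lemma poweR_Lnorm2 (f : T -> R) :
  (Lnorm mu 2%:E (EFin \o f) `^ 2 = \int[mu]_x (f x ^+ 2)%:E)%E.
Proof.
rewrite poweR_Lnorm//; apply: eq_integral => x _ /=.
by rewrite powR_mulrn// real_normK// num_real.
Qed.

Lemma Lnorm2_sqr (f : T -> R) :
  (Lnorm mu 2%:E (EFin \o f) ^+ 2 = \int[mu]_x (f x ^+ 2)%:E)%E.
Proof.
rewrite -poweR_Lnorm2.
have := Lnorm_ge0 mu 2%:E (EFin \o f); case: (Lnorm _ _ _) => [r|_|//].
  by rewrite lee_fin => r0; rewrite poweR_EFin powR_mulrn// EFin_expe.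
by rewrite poweRyr.
Qed.

Lemma Lfun2_of_integral_sqr (f : T -> R) : measurable_fun setT f ->
  (\int[mu]_x (f x ^+ 2)%:E < +oo)%E -> f \in Lfun mu 2%:E.
Proof.
move=> mf fy; rewrite inE; apply/andP; split; rewrite inE//=.
by apply: (@lty_poweRy _ _ 2) => //; rewrite poweR_Lnorm2.
Qed.

Lemma cvgn_geometric_telescope (u_ : nat -> R) (c : R) :
  (forall k, `|u_ k.+1 - u_ k| <= c * 2^-1 ^+ k) -> cvgn u_.
Proof.
move=> uc.
have cs : cvgn (series (telescope u_)).
  apply: normed_cvg; apply: (@series_le_cvg _ _ (geometric c 2^-1)) => //.
  - by move=> n; rewrite /= normr_ge0.
  - by move=> n; exact: (le_trans (normr_ge0 _) (uc n)).
  - by apply: is_cvg_geometric_series; rewrite ger0_norm// invf_lt1// ltr1n.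
have -> : u_ = (fun n => u_ 0%N + series (telescope u_) n).
  by apply/funext => n; rewrite -eq_sum_telescope.
by apply: is_cvgD => //; exact: is_cvg_cst.
Qed.

(** The weights [4 ^+ k] make the sum of the weighted squared increments
    integrable, hence finite almost everywhere; where it is finite, the
    increments are dominated by a geometric sequence. *)
Lemma L2dot_ae_cvg (f_ : nat -> V) :
  (forall k, L2dot (f_ k.+1 - f_ k) (f_ k.+1 - f_ k) <=
    (4 ^+ k)^-1 * (1 / (2 ^ k.+1)%:R)) ->
  \forall x \ae mu, cvgn (fun k => f_ k x).
Proof.
move=> fle; pose h x := (\sum_(0 <= k <oo) (4 ^+ k * (f_ k.+1 x - f_ k x) ^+ 2)%:E)%E.
have mfk k : measurable_fun setT (fun x => (4 ^+ k * (f_ k.+1 x - f_ k x) ^+ 2)%:E).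
  apply/measurable_EFinP; apply: measurable_funM => //; apply: measurable_funX.
  exact: measurable_funB.
have fk0 k x : (0 <= (4 ^+ k * (f_ k.+1 x - f_ k x) ^+ 2)%:E)%E.
  by rewrite lee_fin; apply: mulr_ge0; [exact: exprn_ge0|exact: sqr_ge0].
have h0 x : (0 <= h x)%E by apply: nneseries_ge0.
have ih : mu.-integrable setT h.
  apply/integrableP; split.
    by apply: ge0_emeasurable_sum.
  under eq_integral do rewrite gee0_abs//.
  rewrite /h integral_nneseries//.
  apply: (@le_lt_trans _ _ 1%:E); last exact: ltry.
  apply: le_trans (@epsilon_trick0 R 1 xpredT ler01).
  apply: lee_nneseries => [k _ _|k _]; first exact: integral_ge0.
  under eq_integral do rewrite EFinM.
  rewrite ge0_integralZl//; last 2 first.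
  - by apply/measurable_EFinP; apply: measurable_funX; exact: measurable_funB.
  - by move=> x _; rewrite lee_fin sqr_ge0.
  rewrite [X in (_ * X)%E](_ : _ = (L2dot (f_ k.+1 - f_ k) (f_ k.+1 - f_ k))%:E).
    by rewrite -EFinM lee_fin -ler_pdivlMl ?exprn_gt0.
  by rewrite EFin_L2dot; apply: eq_integral => x _; rewrite expr2.
apply: filterS (integrable_ae measurableT ih) => x /(_ I) hx.
have [c hxc] : exists c, h x = c%:E by exists (fine (h x)); rewrite fineK.
have c0 : 0 <= c by rewrite -lee_fin -hxc.
apply: (@cvgn_geometric_telescope _ (c + 1)) => k.
have : 4 ^+ k * (f_ k.+1 x - f_ k x) ^+ 2 <= c.
  rewrite -lee_fin -hxc; apply: le_trans (nneseries_lim_ge k.+1 _); last first.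
    by move=> n _ _; exact: fk0.
  rewrite big_nat_recr//= leeDr//; apply: sume_ge0 => n _; exact: fk0.
move=> H; rewrite -ler_sqr ?nnegrE ?mulr_ge0 ?addr_ge0//.
rewrite real_normK ?num_real// exprMn -[X in _ * X]exprM mulnC exprM.
rewrite (_ : 2^-1 ^+ 2 = 4^-1 :> R); last by rewrite exprVn -natrX.
rewrite exprVn ler_pdivlMr ?exprn_gt0// mulrC; apply: le_trans H _.
nra.
Qed.

(** A fast subsequence converges almost everywhere; its pointwise limit is the
    limit in the mean by Fatou's lemma. *)
Lemma L2dot_complete : sip_complete L2dot.
Proof.
move=> x_ e e0 xe.
have exN k : exists N, forall m, (N <= m)%N -> e m <= (4 ^+ k)^-1 * (1 / (2 ^ k.+1)%:R).
  have d0 : 0 < (4 ^+ k)^-1 * (1 / (2 ^ k.+1)%:R) :> R.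
    by rewrite mulr_gt0 ?invr_gt0 ?exprn_gt0// divr_gt0// ltr0n expn_gt0.
  have [N _ NP] := @cvgr_lt R nat \oo _ e 0 e0 _ d0.
  by exists N => m Nm; apply/ltW/NP.
have [N NP] := choice exN.
(* Summing the thresholds makes [g] nondecreasing, above each of them, and
   above the identity. *)
pose g k := (k + \sum_(i < k.+1) N i)%N.
have gk k : (k <= g k)%N by rewrite leq_addr.
have gN k : (N k <= g k)%N by rewrite /g big_ord_recr/= addnA leq_addl.
have gS k : (g k <= g k.+1)%N.
  by rewrite leq_add// [leqRHS]big_ord_recr/= leq_addr.
have aecvg := @L2dot_ae_cvg (x_ \o g)
  (fun k => le_trans (xe _ _ (gS k)) (NP _ _ (gN k))).
(* The upper limit is measurable, and is the limit wherever there is one. *)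
pose F x := fine (limn_esup (fun k => (x_ (g k) x)%:E)).
have mF : measurable_fun setT F.
  apply: measurableT_comp => //; apply: measurable_fun_limn_esup => k.
  exact/measurable_EFinP.
have aeF : \forall x \ae mu, (fun k => x_ (g k) x) @ \oo --> F x.
  apply: filterS aecvg => x /cvg_ex[l xl].
  suff -> : F x = l by [].
  have xlE : (fun k => (x_ (g k) x)%:E) @ \oo --> l%:E.
    by apply: cvg_EFin xl; apply: nearW.
  by rewrite /F (cvg_limn_einf_sup xlE).2.
have Fle m : (\int[mu]_x ((F x - x_ m x) ^+ 2)%:E <= (e m)%:E)%E.
  pose f k x := ((x_ (g k) x - x_ m x) ^+ 2)%:E.
  have mf k : measurable_fun setT (f k).
    by apply/measurable_EFinP; apply: measurable_funX; exact: measurable_funB.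
  have f0 k x : (0 <= f k x)%E by rewrite lee_fin sqr_ge0.
  have -> : (\int[mu]_x ((F x - x_ m x) ^+ 2)%:E =
             \int[mu]_x limn_einf (f^~ x))%E.
    apply: ae_eq_integral => //.
    - by apply/measurable_EFinP; apply: measurable_funX; exact: measurable_funB.
    - rewrite /limn_einf; apply: measurableT_comp => //.
      apply: measurable_fun_limn_esup => k; exact: measurableT_comp.
    apply: filterS aeF => x xF _.
    have xmF : (fun k => x_ (g k) x - x_ m x) @ \oo --> F x - x_ m x.
      by apply: cvgB => //; exact: cvg_cst.
    have fF : f^~ x @ \oo --> ((F x - x_ m x) ^+ 2)%:E.
      by apply: cvg_EFin; [exact: nearW|exact: (cvgM xmF xmF)].
    by rewrite (cvg_limn_einf_sup fF).1.
  apply: le_trans (@fatou _ _ _ mu _ measurableT f mf (fun k x _ => f0 k x)) _.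
  rewrite limn_einf_lim; apply: lime_le; first exact: is_cvg_einfs.
  exists 0%N => // k _; apply: (@le_trans _ _ (\int[mu]_x f (maxn k m) x)%E).
    by apply: ereal_inf_lbound; exists (maxn k m) => //=; rewrite leq_maxl.
  apply: (@le_trans _ _ (L2dot (x_ (g (maxn k m)) - x_ m) (x_ (g (maxn k m)) - x_ m))%:E).
    rewrite EFin_L2dot le_eqVlt; apply/orP; left; apply/eqP.
    by apply: eq_integral => x _; rewrite /f expr2.
  by rewrite lee_fin xe// (leq_trans _ (gk _))// leq_maxr.
(* The limit is square integrable as [F - x_ 0] is. *)
have GL : (fun x => F x - x_ 0%N x) \in Lfun mu 2%:E.
  apply: Lfun2_of_integral_sqr; first exact: measurable_funB.
  exact: le_lt_trans (Fle 0%N) (ltry _).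
exists (Lfun_Sub (lee1n 2) GL + x_ 0%N).
apply: (@squeeze_cvgr _ _ _ _ (cst 0) e) => //; last exact: cvg_cst.
apply: nearW => m; rewrite (sip_ge0 L2dot_semi_inner_product)/=.
rewrite -lee_fin; apply: le_trans (Fle m); rewrite EFin_L2dot.
rewrite le_eqVlt; apply/orP; left; apply/eqP; apply: eq_integral => x _.
congr EFin; rewrite LfunBE LfunDE/=; ring.
Qed.

End L2_inner_product.

(** * The space L2: distances and weak convergence *)

Section L2_classes.
Context {d : measure_display} {T : measurableType d} {R : realType}.
Context {mu : {measure set T -> \bar R}}.
Local Notation V := (LfunType mu (lee1n 2)).
Local Notation L2 := (LspaceType2 mu).
Implicit Types u v w z : L2.

Lemma L2_Lfun u : (u : T -> R) \in Lfun mu 2%:E.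
Proof.
rewrite inE; apply/andP; split; rewrite inE/=; last first.
  exact: Lebesgue_finite.
exact: (measurable_funPT (repr (u : {mfun_ mu, T >-> measurableTypeR R}))).
Qed.

Definition L2fun u : V := Lfun_Sub (lee1n 2) (L2_Lfun u).

Local Open Scope quotient_scope.
(** The class of [f]; its chosen representative agrees with [f] only almost
    everywhere. *)
Lemma L2_of_fun (f : V) : exists w : L2, ae_eq mu setT (w : T -> R) f.
Proof.
have mf : @measurable_fun _ _ T (measurableTypeR R) setT f by exact: (measurable_funPT f).
pose fm : {mfun T >-> measurableTypeR R} :=
  @mfun_Sub _ _ T (measurableTypeR R) f (mem_set mf).
pose q : {mfun_ mu, T >-> measurableTypeR R} := \pi fm.
have qf : ae_eq mu setT (q : T -> R) f.
  have : ae_eq_op mu (repr q) fm by rewrite -eqmodE /= reprK.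
  by move=> /asboolP.
have mq : measurable_fun setT (q : T -> R) by exact: (measurable_funPT (repr q)).
have fq : finite_norm mu 2%:E q.
  apply: (@lty_poweRy _ _ 2) => //; rewrite (@poweR_Lnorm2 _ _ _ mu q).
  rewrite (ae_eq_integral (fun x => (f x * f x)%:E)) => //.
  - by rewrite -EFin_L2dot ltry.
  - by apply/measurable_EFinP; exact: measurable_funX.
  - by apply/measurable_EFinP; exact: measurable_funM.
  - by apply: filterS qf => x /(_ I) -> _; rewrite expr2.
pose w : L2 := LebesgueSpace.Pack
  (LebesgueSpace.Class (isFinLebesgue.Build _ _ _ _ _ (lee1n 2) q fq)).
by exists w.
Qed.

Local Notation dot := (@L2dot _ _ _ mu).
Let dotP := @L2dot_semi_inner_product _ _ _ mu.

Definition L2ip u v : R := dot (L2fun u) (L2fun v).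
Definition L2sqd u z : R := dot (L2fun u - L2fun z) (L2fun u - L2fun z).

Lemma L2sqd_ge0 u z : 0 <= L2sqd u z.
Proof. exact: sip_ge0 dotP _. Qed.

Lemma L2dist_sqr u z : (L2dist u z ^+ 2 = (L2sqd u z)%:E)%E.
Proof.
rewrite /L2dist /L2sqd (Lnorm2_sqr mu (fun x => u x - z x)) EFin_L2dot.
by apply: eq_integral => x _; rewrite expr2.
Qed.

Lemma L2sqd_expand u z w :
  L2sqd u w = L2sqd u z + 2 * dot (L2fun u - L2fun z) (L2fun z - L2fun w) + L2sqd z w.
Proof.
rewrite /L2sqd !(sipBl dotP, sipBr dotP) !(sip_sym dotP _ (L2fun u)).
rewrite (sip_sym dotP (L2fun w) (L2fun z)); ring.
Qed.

Lemma L2_weak_cvgP (u_ : nat -> L2) u :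
  L2_weak_cvg u_ u <-> forall v, (fun k => L2ip (u_ k) v) @ \oo --> L2ip u v.
Proof.
have ipE w v : (\int[mu]_x ((w x : R) * v x)%:E = (L2ip w v)%:E)%E by rewrite EFin_L2dot.
have ipkE v : (fun k => \int[mu]_x ((u_ k x : R) * v x)%:E)%E =
    EFin \o (fun k => L2ip (u_ k) v) by apply/funext => k; rewrite /= -ipE.
split => H v; have := H v; first by rewrite ipkE ipE => /fine_cvgP[].
by move=> Hv; rewrite ipkE ipE; apply: cvg_EFin => //; exact: nearW.
Qed.

Lemma L2_weak_cvg_cst u : L2_weak_cvg (fun=> u) u.
Proof. by move=> v; exact: cvg_cst. Qed.

Lemma L2_weak_cvg_dotB (u_ : nat -> L2) u v w : L2_weak_cvg u_ u ->
  (fun k => dot (L2fun (u_ k) - L2fun u) (L2fun v - L2fun w)) @ \oo --> 0.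
Proof.
move=> /L2_weak_cvgP H; rewrite [X in _ --> X](_ : 0 =
   L2ip u v - L2ip u w - (L2ip u v - L2ip u w)); last by rewrite subrr.
under eq_fun do rewrite (sipBl dotP) !(sipBr dotP).
apply: cvgB; last exact: cvg_cst.
by apply: cvgB; exact: H.
Qed.

Lemma L2sqd_weak_lsc (u_ : nat -> L2) u z e : L2_weak_cvg u_ u -> 0 < e ->
  \forall k \near \oo, L2sqd u z - e <= L2sqd (u_ k) z.
Proof.
move=> uu e0; have /(@cvgr_gt R nat \oo _ _ 0)/(_ (- (e / 2))) := L2_weak_cvg_dotB u z uu.
rewrite oppr_lt0 divr_gt0// => /(_ isT); apply: filterS => k.
by rewrite (L2sqd_expand (u_ k) u z) /=; have := L2sqd_ge0 (u_ k) u; lra.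
Qed.

Lemma L2_cvg_sqd (u_ : nat -> L2) u : L2_cvg u_ u ->
  (fun k => L2sqd (u_ k) u) @ \oo --> 0.
Proof.
move=> /fine_cvgP[ufin uu].
rewrite -[X in _ --> X](mulr0 0).
apply: cvg_trans (cvgM uu uu); apply: near_eq_cvg; apply: filterS ufin => k ukfin /=.
apply: EFin_inj; rewrite -L2dist_sqr EFinM fineK//.
Qed.

Lemma L2sqd_strong_usc (u_ : nat -> L2) u z e : L2_cvg u_ u -> 0 < e ->
  \forall k \near \oo, L2sqd (u_ k) z <= L2sqd u z + e.
Proof.
move=> /L2_cvg_sqd uu e0.
have /cvgrPdist_lt/(_ (e / 2)) := uu; rewrite divr_gt0// => /(_ isT) H1.
have := @sip_cvg _ _ _ dotP _ _ (L2fun u - L2fun z) uu.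
move=> /cvgrPdist_lt/(_ (e / 4)); rewrite divr_gt0// => /(_ isT) H2.
near=> k; rewrite (L2sqd_expand (u_ k) u z) (sipBl dotP).
have : `|0 - L2sqd (u_ k) u| < e / 2 by near: k.
rewrite sub0r normrN ger0_norm ?L2sqd_ge0//.
have : `|dot (L2fun u) (L2fun u - L2fun z)
    - dot (L2fun (u_ k)) (L2fun u - L2fun z)| < e / 4 by near: k.
rewrite ltr_norml => /andP[]; lra.
Unshelve. all: by end_near. Qed.

(** Under weak convergence the squared distances to [z] and to [w] differ by
    an affine functional that converges, so an asymptotic bound can be moved
    from one centre to the other. *)
Lemma L2_weak_cvg_sqd_le (u_ : nat -> L2) u z w :
  L2_weak_cvg u_ u ->
  (forall e, 0 < e -> \forall k \near \oo, L2sqd (u_ k) z <= L2sqd u z + e) ->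
  forall e, 0 < e -> \forall k \near \oo, L2sqd (u_ k) w <= L2sqd u w + e.
Proof.
move=> uu uz e e0.
have /cvgrPdist_lt/(_ (e / 4)) := L2_weak_cvg_dotB z w uu.
rewrite divr_gt0// => /(_ isT) H1; have H2 := uz (e / 2) ltac:(by rewrite divr_gt0).
near=> k; rewrite (L2sqd_expand (u_ k) z w) (L2sqd_expand u z w).
have : L2sqd (u_ k) z <= L2sqd u z + e / 2 by near: k.
have : `|0 - dot (L2fun (u_ k) - L2fun u) (L2fun z - L2fun w)| < e / 4 by near: k.
rewrite sub0r normrN ltr_norml !(sipBl dotP).
move: (L2sqd _ _) (L2sqd _ _) (L2sqd _ _) (dot _ _) (dot _ _) (dot _ _).
by move=> a b c a' b' c' /andP[]; lra.
Unshelve. all: by end_near. Qed.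

(** Treating all components with one countable family of inner products gives
    a common subsequence. *)
Lemma L2_weak_compactness (I : countType)
    (u_ : nat -> I -> L2) (z : I -> L2) (M : I -> R) :
  (forall i, \forall k \near \oo, L2sqd (u_ k i) (z i) <= M i) ->
  exists2 f : nat -> nat, (forall n, (n <= f n)%N) &
  exists w : I -> L2, forall i, L2_weak_cvg (fun k => u_ (f k) i) (w i).
Proof.
move=> uM.
pose M' i := 2 * M i + 2 * L2ip (z i) (z i).
have uM' i : \forall k \near \oo, L2ip (u_ k i) (u_ k i) <= M' i.
  apply: filterS (uM i) => k H.
  have := sip_le_half_sqr dotP (L2fun (u_ k i)) (2 *: L2fun (z i)).
  rewrite !(sipZl dotP) !(sipZr dotP) ler_norml => /andP[_].
  move: H; rewrite /L2sqd (sip_sqrB dotP) /M' /L2ip; lra.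
pose a (p : I * nat) k := L2ip (u_ k p.1) (u_ p.2 p.1).
have [p|f nf acvg] := @diagonal_subsequence R _ a.
  exists ((M' p.1 + L2ip (u_ p.2 p.1) (u_ p.2 p.1)) / 2).
  apply: filterS (uM' p.1) => k H; apply: le_trans (sip_le_half_sqr dotP _ _) _.
  by rewrite ler_wpM2r// lerD2r.
exists f => //.
have ex i : exists w : L2, L2_weak_cvg (fun k => u_ (f k) i) w.
  have [|m|g gP] := @weak_limit R _ dot dotP (fun k => L2fun (u_ (f k) i)) (M' i)
     (@L2dot_complete _ _ _ mu).
  - exact: (subseq_cvgy nf (uM' i)).
  - exact: acvg (i, f m).
  have [w wg] := L2_of_fun g; exists w; apply/L2_weak_cvgP => v.
  rewrite /L2ip (@L2dot_ae _ _ _ mu (L2fun w) g (L2fun v) (L2fun v)) //.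
  exact: ae_eq_refl.
have [w wP] := choice ex; by exists w.
Qed.

End L2_classes.

(** * Lower and upper limits of sequences in the extended reals *)

Section limits_inferior.
Context {R : realType}.
Local Open Scope ereal_scope.
Implicit Types (a b : nat -> \bar R) (x y : \bar R).

Lemma limn_einfE a : limn_einf a = ereal_sup (range (einfs a)).
Proof. by rewrite limn_einf_lim; apply/cvg_lim => //; exact: cvg_einfs_sup. Qed.

Lemma limn_esupE a : limn_esup a = ereal_inf (range (esups a)).
Proof. by rewrite limn_esup_lim; apply/cvg_lim => //; exact: cvg_esups_inf. Qed.

Lemma lt_limn_einf_near a x : x < limn_einf a -> \forall k \near \oo, x < a k.
Proof.
rewrite limn_einfE => /ereal_sup_gt[_ [n _ <-]] xn; exists n => // k /= nk.
by apply: lt_le_trans xn _; apply: ereal_inf_lbound; exists k.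
Qed.

Lemma limn_esup_lt_near a x : limn_esup a < x -> \forall k \near \oo, a k < x.
Proof.
rewrite limn_esupE => /ereal_inf_lt[_ [n _ <-]] xn; exists n => // k /= nk.
by apply: le_lt_trans xn; apply: ereal_sup_ubound; exists k.
Qed.

Lemma limn_einf_lt_frequently a x : limn_einf a < x ->
  forall n, exists2 k, (n <= k)%N & a k < x.
Proof.
rewrite limn_einfE => ax n.
have /ereal_inf_lt[_ [k nk <-] akx] : einfs a n < x.
  by apply: le_lt_trans ax; apply: ereal_sup_ubound; exists n.
by exists k.
Qed.

Lemma limn_einf_le_esup a b : (\forall k \near \oo, a k <= b k) ->
  limn_einf a <= limn_esup b.
Proof.
move=> [K _ ab]; rewrite limn_einfE limn_esupE.
apply: ge_ereal_sup => _ [m _ <-]; apply: le_ereal_inf_tmp => _ [n _ <-].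
pose k := maxn K (maxn m n).
apply: (@le_trans _ _ (a k)).
  by apply: ereal_inf_lbound; exists k => //=; rewrite /k !leq_max leqnn !orbT.
apply: (@le_trans _ _ (b k)); first by apply: ab; rewrite /= /k leq_maxl.
by apply: ereal_sup_ubound; exists k => //=; rewrite /k !leq_max leqnn !orbT.
Qed.

Lemma limn_esup_cst x : limn_esup (fun=> x) = x.
Proof. by rewrite (cvg_limn_einf_sup (cvg_cst x)).2. Qed.

Lemma limn_einf_cst x : limn_einf (fun=> x) = x.
Proof. by rewrite (cvg_limn_einf_sup (cvg_cst x)).1. Qed.

Lemma limn_einf_le_near a x : (\forall k \near \oo, a k <= x) -> limn_einf a <= x.
Proof. by move=> ax; rewrite -[leRHS]limn_esup_cst; exact: limn_einf_le_esup. Qed.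

Lemma le_limn_einf_near a b : (\forall k \near \oo, a k <= b k) ->
  limn_einf a <= limn_einf b.
Proof.
move=> [K _ ab]; rewrite !limn_einfE; apply: ge_ereal_sup => _ [m _ <-].
apply: (@le_trans _ _ (einfs b (maxn K m))).
  apply: le_ereal_inf_tmp => _ [k /= kK <-].
  move: kK; rewrite geq_max => /andP[Kk mk]; apply: (@le_trans _ _ (a k)).
    by apply: ereal_inf_lbound; exists k.
  exact: ab.
by apply: ereal_sup_ubound; exists (maxn K m).
Qed.

Lemma limn_einf_EFinD_ge (s : R) (s_ : nat -> R) x b :
  (forall e : R, (0 < e)%R -> \forall k \near \oo, (s - e <= s_ k)%R) ->
  x <= limn_einf b ->
  s%:E + x <= limn_einf (fun k => (s_ k)%:E + b k).
Proof.
move=> ss xb; apply/lee_addgt0Pr => e e0.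
rewrite -leeBlDr// -EFinN addeAC -EFinD.
apply: (@le_trans _ _ ((s - e)%:E + limn_einf b)); first exact: leeD2l.
rewrite -limn_einf_shift//; apply: le_limn_einf_near.
by apply: filterS (ss e e0) => k H; rewrite leeD2r// lee_fin.
Qed.

Lemma lee_real_upper_bounds x y : (forall c : R, x < c%:E -> y <= c%:E) -> y <= x.
Proof.
case: x => [r| |] H; last 2 first.
- exact: leey.
- case: y H => [s /(_ (s - 1)%R (ltNyr _))|/(_ 0%R (ltNyr _))|//]; last by [].
  by rewrite lee_fin lerBrDl gerDr ler10.
by apply/lee_addgt0Pr => e e0; rewrite -EFinD; apply: H; rewrite lte_fin ltrDl.
Qed.

End limits_inferior.

(** * Sequences in a first countable space *)

Lemma closure_sequences_to (X : topologicalType) (Lambda : set X) (l : X) :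
  first_countable X -> closure Lambda l -> exists l_, sequences_to Lambda l l_.
Proof.
move=> /(_ l)[B [cB Bl] Bbase] cl.
(* [f] numbers the given base of neighbourhoods; [C n] is the intersection of
   those with number below [n]. *)
have [f finj] := countable_injP _ cB.
pose C n := [set x | forall i : 'I_n, forall U, B U -> f U = i -> U x].
have Cl n : nbhs l (C n).
  apply: filter_forall => i.
  have [[U [BU fU]]|noU] := pselect (exists U, B U /\ f U = i).
    apply: filterS (Bl _ BU) => x Ux V BV fV.
    by rewrite (finj V U) ?inE// fV fU.
  by apply: filterS filterT => x _ V BV fV; exfalso; apply: noU; exists V.
have [l_ lP] := choice (fun n => cl _ (Cl n)).
exists l_; split => [k|A Al]; first by case: (lP k).
have [U BU UA] := Bbase A Al.
exists (f U).+1 => // k /= Uk; apply: UA; have [_ Ck] := lP k.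
exact: (Ck (Ordinal Uk) U BU).
Qed.

Lemma sequences_to_subseq (X : topologicalType) (Lambda : set X) (l : X)
    l_ (f : nat -> nat) :
  (forall n, (n <= f n)%N) -> sequences_to Lambda l l_ ->
  sequences_to Lambda l (l_ \o f).
Proof.
by move=> nf [Ll ll]; split => [k|]; [exact: Ll|exact: cvg_comp (subseq_cvgy nf) ll].
Qed.

(** * Minimizers and Gamma-convergence *)

Section Gamma_convergence.
Context {d : measure_display} {T : measurableType d} {R : realType}.
Context {mu : {measure set T -> \bar R}}.
Local Notation L2 := (LspaceType2 mu).
Implicit Types (u v w z : L2) (F G : L2 -> \bar R).

Lemma Gamma_lim_argmin (J_ : nat -> L2 -> \bar R) J (u_ : nat -> L2) u :
  Gamma_lim J_ J -> (forall k, argmin (J_ k) (u_ k)) -> L2_weak_cvg u_ u ->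
  argmin J u.
Proof.
move=> [Jinf Jsup] umin uu v; have [v_ _ vJ] := Jsup v.
apply: le_trans (Jinf _ _ uu) _; apply: le_trans vJ.
by apply: limn_einf_le_esup; apply: nearW => k; exact: umin.
Qed.

Lemma Gamma_lim_cst F G : weakly_lsc F -> Gamma_lim (fun=> F) G -> G = F.
Proof.
move=> Flsc [Ginf Gsup]; apply/funext => u; apply/eqP; rewrite eq_le.
apply/andP; split.
  by have := Ginf _ _ (@L2_weak_cvg_cst _ _ _ mu u); rewrite limn_einf_cst.
have [v_ vu vG] := Gsup u; apply: le_trans vG; apply: le_trans (Flsc _ _ vu) _.
exact: limn_einf_sup.
Qed.

Lemma Gamma_lim_minimizers_bounded (J_ : nat -> L2 -> \bar R) J (u_ : nat -> L2) v :
  Gamma_lim J_ J -> (forall k, argmin (J_ k) (u_ k)) -> (J v < +oo)%E ->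
  exists C : R, \forall k \near \oo, (J_ k (u_ k) <= C%:E)%E.
Proof.
move=> [_ Jsup] umin Jv; have [v_ _ vJ] := Jsup v.
have [C JC] : exists C : R, (J v < C%:E)%E.
  move: Jv; case: (J v) => [r _|//|_]; last by exists 0; rewrite ltNyr.
  by exists (r + 1); rewrite lte_fin ltrDl.
exists C; apply: filterS (limn_esup_lt_near (le_lt_trans vJ JC)) => k H.
exact: le_trans (umin k _) (ltW H).
Qed.

Definition penalized z F u := (L2dist u z ^+ 2 + F u)%E.

Lemma penalizedE z F u : penalized z F u = ((L2sqd u z)%:E + F u)%E.
Proof. by rewrite /penalized L2dist_sqr. Qed.

Lemma penalized_lsc z F : weakly_lsc F -> weakly_lsc (penalized z F).
Proof.
move=> Flsc u_ u uu; rewrite penalizedE.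
rewrite [leRHS](_ : _ = limn_einf (fun k => (L2sqd (u_ k) z)%:E + F (u_ k))%E);
  last first.
  by congr limn_einf; apply/funext => k; rewrite /= penalizedE.
apply: limn_einf_EFinD_ge; last exact: Flsc.
by move=> e e0; exact: L2sqd_weak_lsc.
Qed.

(** The direct method: a minimizing sequence is bounded because of the
    quadratic term. *)
Lemma penalized_argmin z F : (forall u, (0 <= F u)%E) -> weakly_lsc F ->
  (exists u, (F u < +oo)%E) -> exists u, argmin (penalized z F) u.
Proof.
move=> F0 Flsc [u0 Fu0]; pose J := penalized z F.
have J0 u : (0 <= J u)%E by rewrite /J penalizedE adde_ge0// lee_fin L2sqd_ge0.
pose m := ereal_inf (range J).
have mJ u : (m <= J u)%E by apply: ereal_inf_lbound; exists u.
have m0 : (0 <= m)%E by apply: le_ereal_inf_tmp => _ [u _ <-].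
have mfin : m \is a fin_num.
  rewrite ge0_fin_numE//; apply: le_lt_trans (mJ u0) _.
  by rewrite /J penalizedE lte_add_pinfty// ltry.
have ex k : exists u, (J u < m + (k.+1%:R^-1)%:E)%E.
  have [|_ [u _ <-] H] := @lb_ereal_inf_adherent R (range J) k.+1%:R^-1 _ mfin.
    by rewrite invr_gt0.
  by exists u.
have [u_ uP] := choice ex.
have [i|f nf [w wP]] := @L2_weak_compactness _ _ _ mu unit (fun k _ => u_ k)
    (fun=> z) (fun=> fine m + 1).
  apply: nearW => k; rewrite -lee_fin EFinD (fineK mfin).
  apply: (@le_trans _ _ (J (u_ k))); first by rewrite /J penalizedE leeDl.
  apply: le_trans (ltW (uP k)) _; rewrite leeD2l// lee_fin invf_le1 ?ltr0n//.
  by rewrite ler1n.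
exists (w tt) => v; apply: le_trans (mJ v).
apply: le_trans (penalized_lsc z Flsc (wP tt)) _.
apply/lee_addgt0Pr => e e0; apply: limn_einf_le_near.
have /cvgrPdist_lt/(_ e e0) := @cvg_harmonic R.
move=> hlt; have : \forall k \near \oo, `|0 - harmonic (f k)| < e := subseq_cvgy nf hlt.
apply: filterS => k /=; rewrite sub0r normrN ger0_norm ?invr_ge0// => H.
by apply: le_trans (ltW (uP (f k))) _; rewrite leeD2l// lee_fin ltW.
Qed.

(** Let [v_] converge strongly to [u] with limsup [F_ k (v_ k)] at most [F u].
    Minimality gives |u_k - z|^2 + F_k(u_k) <= |v_k - z|^2 + F_k(v_k).  As
    liminf F_k(u_k) >= F(u) >= limsup F_k(v_k), and F(u) is finite, the
    regularizing terms cancel in the limit and limsup |u_k - z| <= |u - z|. *)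
Lemma Mosco_lim_minimizers (F_ : nat -> L2 -> \bar R) F z (u_ : nat -> L2) u (C : R) :
  (forall k v, (0 <= F_ k v)%E) -> Mosco_lim F_ F ->
  (forall k, argmin (penalized z (F_ k)) (u_ k)) ->
  (\forall k \near \oo, (penalized z (F_ k) (u_ k) <= C%:E)%E) ->
  L2_weak_cvg u_ u ->
  forall w e, 0 < e -> \forall k \near \oo, L2sqd (u_ k) w <= L2sqd u w + e.
Proof.
move=> F0 [[Finf _] Fstrong] umin uC uu w.
apply: (@L2_weak_cvg_sqd_le _ _ _ _ _ _ z) => // e e0.
have [v_ vu vF] := Fstrong u.
have FuC : \forall k \near \oo, (F_ k (u_ k) <= C%:E)%E.
  apply: filterS uC => k; apply: le_trans.
  by rewrite penalizedE leeDr// lee_fin L2sqd_ge0.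
have Fu0 : (0 <= F u)%E.
  apply: le_trans vF; rewrite -[leLHS]limn_einf_cst; apply: limn_einf_le_esup.
  by apply: nearW => k; exact: F0.
have FufinC : (F u <= C%:E)%E.
  by apply: le_trans (Finf _ _ uu) _; exact: limn_einf_le_near.
have [r Fur] : exists r, F u = r%:E.
  by exists (fine (F u)); rewrite fineK// ge0_fin_numE// (le_lt_trans FufinC)// ltry.
have e3 : 0 < e / 3 by rewrite divr_gt0.
have H1 : \forall k \near \oo, (F_ k (v_ k) < (r + e / 3)%:E)%E.
  by apply: limn_esup_lt_near; apply: le_lt_trans vF _; rewrite Fur lte_fin ltrDl.
have H2 : \forall k \near \oo, ((r - e / 3)%:E < F_ k (u_ k))%E.
  apply: lt_limn_einf_near; apply: lt_le_trans (Finf _ _ uu).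
  by rewrite Fur lte_fin ltrBlDr ltrDl.
have H3 := L2sqd_strong_usc z vu e3.
near=> k.
have h1 : (F_ k (v_ k) < (r + e / 3)%:E)%E by near: k.
have h2 : ((r - e / 3)%:E < F_ k (u_ k))%E by near: k.
have h3 : L2sqd (v_ k) z <= L2sqd u z + e / 3 by near: k.
have h4 : (F_ k (u_ k) <= C%:E)%E by near: k.
move: (umin k (v_ k)) h1 h2 h4 (F0 k (v_ k)); rewrite !penalizedE.
case: (F_ k (u_ k)) => [s| |]//; case: (F_ k (v_ k)) => [t| |]//.
rewrite -!EFinD !lee_fin !lte_fin; move: h3.
by move: (L2sqd _ _) (L2sqd _ _) (L2sqd _ _) => a b c; lra.
Unshelve. all: by end_near. Qed.

End Gamma_convergence.

(** * The extension and the relaxation of the upper level *)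

Section bilevel_relaxation.
Context {d : measure_display} {T : measurableType d} {R : realType}.
Context {mu : {measure set T -> \bar R}}.
Local Notation L2 := (LspaceType2 mu).
Context {N : nat} {X : topologicalType}.
Implicit Types (w : 'I_N -> L2).
Variables (uc ueta : 'I_N -> L2) (Lambda : set X) (Reg : X -> L2 -> \bar R).
Hypotheses (Reg_ge0 : forall l, Lambda l -> forall u, (0 <= Reg l u)%E)
  (Reg_lsc : forall l, Lambda l -> weakly_lsc (Reg l))
  (Reg_proper : forall l, Lambda l -> exists u, (Reg l u < +oo)%E).
Variable Jbar : X -> 'I_N -> L2 -> \bar R.
Local Notation J := (lower_level ueta Reg).
Local Notation I := (fun l' => upper_level uc (J l')).
Hypothesis JbarP : forall l, closure Lambda l -> forall j : 'I_N,
    Gamma_lim_at Lambda (fun l' => J l' j) l (Jbar l j).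

Lemma L2dist2_vecE w w' : L2dist2_vec w w' = (\sum_(j < N) L2sqd (w j) (w' j))%:E.
Proof. by rewrite /L2dist2_vec -sumEFin; apply: eq_bigr => j _; rewrite L2dist_sqr. Qed.

Lemma solutions_nonempty l : Lambda l -> exists w, solutions (J l) w.
Proof.
move=> Ll; have ex j : exists u, argmin (J l j) u.
  exact: (penalized_argmin (ueta j) (Reg_ge0 Ll) (Reg_lsc Ll) (Reg_proper Ll)).
by have [w wP] := choice ex; exists w.
Qed.

Lemma Jbar_in_Lambda l : Lambda l -> Jbar l = J l.
Proof.
move=> Ll; apply/funext => j; apply: Gamma_lim_cst.
  exact: penalized_lsc (Reg_lsc Ll).
have := JbarP (@subset_closure _ Lambda l Ll) j => /(_ (fun=> l)); apply.
by split => //; exact: cvg_cst.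
Qed.

Lemma solutions_weak_limit l l_ (w_ : nat -> 'I_N -> L2) w :
  sequences_to Lambda l l_ -> closure Lambda l ->
  (forall k, solutions (J (l_ k)) (w_ k)) ->
  (forall j, L2_weak_cvg (fun k => w_ k j) (w j)) -> solutions (Jbar l) w.
Proof.
move=> ll cl wsol ww j.
exact: (Gamma_lim_argmin (JbarP cl j ll) (fun k => wsol k j) (ww j)).
Qed.

Lemma upper_level_le_relaxation l : closure Lambda l ->
  (upper_level uc (Jbar l) <= relaxation Lambda I l)%E.
Proof.
move=> cl; apply: le_ereal_inf_tmp => _ [l_ ll <-].
apply: lee_real_upper_bounds => c /limn_einf_lt_frequently Ic.
(* Where [I] is below [c] the solution set is nonempty. *)
have ex n : exists k, exists w, [/\ (n <= k)%N, solutions (J (l_ k)) w &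
    \sum_(j < N) L2sqd (w j) (uc j) < c].
  have [k nk /ereal_inf_lt[_ [w wsol <-]]] := Ic n.
  by rewrite L2dist2_vecE lte_fin => wc; exists k, w.
have [f fP] := choice ex; have [w_ wP] := choice fP.
have nf n : (n <= f n)%N by have [] := wP n.
have [j|g ng [w ww]] := @L2_weak_compactness _ _ _ mu 'I_N w_ uc (fun=> c).
  apply: nearW => k; have [_ _] := wP k; rewrite (bigD1 j)//= => /ltW.
  by apply: le_trans; rewrite lerDl sumr_ge0// => i _; exact: L2sqd_ge0.
have wsol : solutions (Jbar l) w.
  apply: (@solutions_weak_limit l (l_ \o f \o g) (w_ \o g)) => //.
    by do 2 apply: sequences_to_subseq => //.
  by move=> k; have [] := wP (g k).
apply: (@le_trans _ _ (L2dist2_vec w uc)); first by apply: ereal_inf_lbound; exists w.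
rewrite L2dist2_vecE lee_fin; apply/ler_addgt0Pr => e e0.
(* The error is shared between components; [N.+1] because [N] may be 0. *)
have e'0 : 0 < e / N.+1%:R by rewrite divr_gt0.
have near_w : \forall k \near \oo, forall j,
    L2sqd (w j) (uc j) - e / N.+1%:R <= L2sqd (w_ (g k) j) (uc j).
  by apply: filter_forall => j; exact: L2sqd_weak_lsc (ww j) e'0.
have [k kP] := filter_ex near_w.
have [_ _ /ltW wc] := wP (g k).
apply: (@le_trans _ _ (\sum_(j < N) (L2sqd (w_ (g k) j) (uc j) + e / N.+1%:R))).
  by apply: ler_sum => j _; rewrite -lerBlDr.
rewrite big_split/= lerD// sumr_const card_ord -[leLHS]mulr_natr mulrAC.
by rewrite ler_pdivrMr// ler_wpM2l ?(ltW e0)// ler_nat.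
Qed.

Lemma relaxation_le_at_Lambda l : Lambda l ->
  (relaxation Lambda I l <= upper_level uc (Jbar l))%E.
Proof.
move=> Ll; rewrite (Jbar_in_Lambda Ll); apply: ereal_inf_lbound.
exists (fun=> l); last by rewrite (limn_einf_cst (I l)).
by split => // A Al; exact: cvg_cst.
Qed.

(** Components of solutions are chosen independently, so uniqueness of the
    vector solution passes to each component. *)
Lemma argmin_Jbar_eq l j w u : solutions (Jbar l) = [set w] ->
  argmin (Jbar l j) u -> u = w j.
Proof.
move=> Kw uJ; have wK : solutions (Jbar l) w by rewrite Kw.
have : solutions (Jbar l) (fun i => if i == j then u else w i).
  by move=> i /=; case: eqVneq => [->//|_]; exact: wK.
by rewrite Kw => <-; rewrite eqxx.
Qed.

Lemma relaxation_le_notin_Lambda l w :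
  first_countable X -> closure Lambda l ->
  (exists Rbar, Mosco_lim_at Lambda Reg l Rbar) ->
  solutions (Jbar l) = [set w] ->
  (relaxation Lambda I l <= upper_level uc (Jbar l))%E.
Proof.
move=> fcX cl [Rbar RbarP] Kw.
have [l_ ll] := closure_sequences_to fcX cl.
have [w_ wP] := choice (fun k => solutions_nonempty (ll.1 k)).
(* Boundedness of the minimizers needs a point where [Jbar l j] is finite.  If
   there is none, everything minimizes it, and uniqueness makes L2 trivial. *)
have dichotomy j : (exists C : R, \forall k \near \oo, (J (l_ k) j (w_ k j) <= C%:E)%E) \/
    (forall u, u = w j).
  have [[v Jv]|noJ] := pselect (exists v, (Jbar l j v < +oo)%E).
    left; exact: Gamma_lim_minimizers_bounded (JbarP cl j ll) (fun k => wP k j) Jv.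
  right => u; apply: argmin_Jbar_eq Kw _ => v.
  apply: (@le_trans _ _ +oo%E); first exact: leey.
  by rewrite leNgt; apply/negP => ?; apply: noJ; exists v.
have bnd j : exists M, \forall k \near \oo, L2sqd (w_ k j) (ueta j) <= M.
  have [[C CP]|eqw] := dichotomy j; last first.
    by exists (L2sqd (w j) (ueta j)); apply: nearW => k; rewrite (eqw (w_ k j)).
  exists C; apply: filterS CP => k; rewrite -lee_fin -L2dist_sqr; apply: le_trans.
  by rewrite /lower_level leeDl// Reg_ge0//; exact: ll.1.
have [M MP] := choice bnd.
have [f nf [w' ww']] := @L2_weak_compactness _ _ _ mu 'I_N w_ ueta M MP.
have llf := sequences_to_subseq nf ll.
have w'E : w' = w.
  have : solutions (Jbar l) w'.
    by apply: (@solutions_weak_limit l (l_ \o f) (w_ \o f)) => // k; exact: wP.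
  by rewrite Kw.
rewrite {w'}w'E in ww'.
have le_near j e : 0 < e ->
    \forall k \near \oo, L2sqd (w_ (f k) j) (uc j) <= L2sqd (w j) (uc j) + e.
  move=> e0; have [[C CP]|eqw] := dichotomy j; last first.
    by apply: nearW => k; rewrite (eqw (w_ (f k) j)) lerDl ltW.
  apply: (@Mosco_lim_minimizers _ _ _ _ (Reg \o l_ \o f) Rbar (ueta j)
    (fun k => w_ (f k) j) (w j) C) => //.
  - by move=> k v; apply: Reg_ge0; exact: ll.1.
  - exact: RbarP llf.
  - by move=> k; exact: (wP (f k) j).
  - exact: (subseq_cvgy nf CP).
apply: (@le_trans _ _ (limn_einf (I \o (l_ \o f)))).
  by apply: ereal_inf_lbound; exists (l_ \o f).
rewrite /upper_level [in leRHS]Kw image_set1 ereal_inf1 L2dist2_vecE.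
apply/lee_addgt0Pr => e e0; apply: limn_einf_le_near.
have e'0 : 0 < e / N.+1%:R by rewrite divr_gt0.
have : \forall k \near \oo, forall j,
   L2sqd (w_ (f k) j) (uc j) <= L2sqd (w j) (uc j) + e / N.+1%:R.
  by apply: filter_forall => j; exact: le_near.
apply: filterS => k kP; apply: (@le_trans _ _ (L2dist2_vec (w_ (f k)) uc)).
  by apply: ereal_inf_lbound; exists (w_ (f k)) => //; exact: wP.
rewrite L2dist2_vecE -EFinD lee_fin.
apply: (@le_trans _ _ (\sum_(j < N) (L2sqd (w j) (uc j) + e / N.+1%:R))).
  by apply: ler_sum => j _; exact: kP.
rewrite big_split/= lerD2l sumr_const card_ord -[leLHS]mulr_natr mulrAC.
by rewrite ler_pdivrMr// ler_wpM2l ?(ltW e0)// ler_nat.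
Qed.

End bilevel_relaxation.

Unset Implicit Arguments.

Theorem theorem2p5 (R : realType) (n : nat) (Omega : set 'rV[R]_n)
  (openOmega : open Omega) (bndOmega : bounded_set Omega)
  (N : nat) (uc ueta : 'I_N -> L2_on openOmega)
  (X : topologicalType) (fcX : first_countable X) (Lambda : set X)
  (Reg : X -> L2_on openOmega -> \bar R)
  (Reg_ge0 : forall l, Lambda l -> forall u, (0 <= Reg l u)%E)
  (Reg_lsc : forall l, Lambda l -> weakly_lsc (Reg l))
  (Reg_proper : forall l, Lambda l -> exists u, (Reg l u < +oo)%E)
  (Jbar : X -> 'I_N -> L2_on openOmega -> \bar R)
  (JbarP : forall l, closure Lambda l -> forall j : 'I_N,
    Gamma_lim_at Lambda (fun l' => lower_level ueta Reg l' j) l (Jbar l j))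
  (Rbar_ex : forall l, closure Lambda l ->
    exists Rbar : L2_on openOmega -> \bar R, Mosco_lim_at Lambda Reg l Rbar)
  (Kbar_singleton : forall l, closure Lambda l -> ~ Lambda l ->
    exists w, solutions (Jbar l) = [set w]) :
  forall l, closure Lambda l ->
    upper_level uc (Jbar l) =
    relaxation Lambda (fun l' => upper_level uc (lower_level ueta Reg l')) l.
Proof.
move=> l cl; apply/eqP; rewrite eq_le; apply/andP; split.
  exact: upper_level_le_relaxation.
have [Ll|nLl] := pselect (Lambda l).
  exact: relaxation_le_at_Lambda.
have [w Kw] := Kbar_singleton l cl nLl.
exact: relaxation_le_notin_Lambda fcX cl (Rbar_ex l cl) Kw.
Qed.
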